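(* Let $k\ge 2$ be an integer, let $\alpha,\beta,\gamma,\delta$ be complex constants, set $q:=1+\beta\gamma-\alpha\delta$, and assume that $1+\beta\gamma[n]\neq 0$ for every positive integer $n$. For a tuple $p=(p_1,\dots,p_k)$ of distinct complex parameters, define the function $\Phi_p\in F(L)^W$ by $$\Phi_p|_{L_+}=\sum_{\sigma\in\mathfrak{S}_k}\ \prod_{1\le i<j\le k}\left(1+\frac{(\alpha+\beta p_{\sigma(j)})(\gamma+\delta p_{\sigma(i)})}{p_{\sigma(j)}-p_{\sigma(i)}}\right)\prod_{i=1}^kp_{\sigma(i)}^{-\epsilon_i}.$$ Then $\Phi_p$ is an eigenfunction of the discrete Hamiltonian $H$ with eigenvalue $\sum_{i=1}^kp_i$.
   Context: $V=\bigoplus_{i=1}^k\mathbb{R}v_i$ is Euclidean space with orthonormal basis $\{v_i\}$; $\{\epsilon_i\}$ is the dual basis of $V^*$; $\alpha_{ij}=\epsilon_i-\epsilon_j$. $L=\bigoplus_{i=1}^k\mathbb{Z}v_i$, and $F(L)$ is the space of functions $L\to\mathbb{C}$. $W\cong\mathfrak{S}_k$ is the Weyl group of type $A_{k-1}$, which permutes the basis vectors $v_1,\dots,v_k$ and acts on $F(L)$ by $(wf)(x)=f(w^{-1}x)$; $F(L)^W$ is the subspace of $W$-invariant functions. $L_+=\{x\in L\mid \epsilon_1(x)\ge\cdots\ge\epsilon_k(x)\}$; an element of $F(L)^W$ is determined by its restriction to $L_+$, which may be arbitrary. The function $p_{\sigma(i)}^{-\epsilon_i}$ takes the value $p_{\sigma(i)}^{-\epsilon_i(x)}$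 at $x$. $[n]=(1-q^n)/(1-q)$ is the $q$-integer (that is, $1+q+\cdots+q^{n-1}$, with $[0]=0$), $[n]!=\prod_{a=1}^n[a]$ for $n>0$, and $[0]!=1$. $(\widehat{X}_if)(x)=f(x-v_i)$ for $f\in F(L)$. For $x\in L$ let $d_i^+(x)=\#\{p\mid i<p\le k,\ \alpha_{ip}(x)=0\}$ and $d_i^-(x)=\#\{p\mid 1\le p<i,\ \alpha_{pi}(x)=0\}$, and let $\delta_{j_1,\dots,j_r}(x)=1$ if $\epsilon_{j_1}(x)=\cdots=\epsilon_{j_r}(x)$ and $0$ otherwise ($\delta_j\equiv1$ when $r=1$). The discrete Hamiltonian is the operator on $F(L)$ $$H=-\alpha\gamma\sum_{j=1}^k\frac{[d_j^+]}{1+\beta\gamma[d_j^+]}+\sum_{r=1}^k(-\beta\delta)^{r-1}[r-1]!\,q^{-r(r-1)/2}\sum_{1\le j_1<\cdots<j_r\le k}\frac{q^{\sum_{p=1}^rd_{j_p}^-}\,\delta_{j_1,\dots,j_r}}{\prod_{p=0}^{r-1}(1+\beta\gamma[d_{j_1}^++d_{j_1}^--p])}\prod_{p=1}^r\widehat{X}_{j_p},$$ where functions on $L$ act by multiplication (after the shifts are applied), and terms are $0$ at points where $\delta_{j_1,\dots,j_r}(x)=0$. At points where $\delta_{j_1,\dots,j_r}(x)=1$ the total exponent $\sum_{p=1}^r d_{j_p}^-(x)-r(r-1)/2$ of $q$ is a non-negative integer, and the two powers of $q$ are read as this single power. *)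

(* Defs.v *)
From HB Require Import structures.
From mathcomp Require Import all_boot all_order all_fingroup all_algebra.
From mathcomp Require Export complex reals.

Set Implicit Arguments.
Unset Strict Implicit.
Unset Printing Implicit Defensive.
Import Order.TTheory GRing.Theory Num.Theory.
Local Open Scope ring_scope.
Local Open Scope complex_scope.

Section QNumbers.
Variable F : fieldType.

Definition qint (q : F) (n : nat) : F := \sum_(a < n) q ^+ a.

Definition qfact (q : F) (n : nat) : F := \prod_(1 <= a < n.+1) qint q a.

End QNumbers.

(* An element x of L = (+)_i Z v_i is the row vector of its coordinates
   epsilon_i(x); indices run over {0, ..., k-1} instead of {1, ..., k}. *)
Notation lattice k := 'rV[int]_k.

Section Lattice.
Variable k : nat.

Definition basisv (i : 'I_k) : lattice k := delta_mx 0 i.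

Definition epsilon (i : 'I_k) (x : lattice k) : int := x 0 i.

Definition alpha_root (i j : 'I_k) (x : lattice k) : int :=
  epsilon i x - epsilon j x.

(* The linear map with w v_i = v_(w i), that is
   epsilon_i(w x) = epsilon_(w^-1 i)(x). *)
Definition weyl_act (w : 'S_k) (x : lattice k) : lattice k :=
  \row_i epsilon (w^-1%g i) x.

Definition dominant (x : lattice k) : Prop :=
  forall i j : 'I_k, (i <= j)%N -> epsilon j x <= epsilon i x.

(* The point of L_+ in the Weyl orbit of x: its coordinates in weakly
   decreasing order. *)
Definition dominant_rep (x : lattice k) : lattice k :=
  \row_(i < k) nth 0 (sort >=%R [seq epsilon j x | j <- enum 'I_k]) i.

Definition dplus (i : 'I_k) (x : lattice k) : nat :=
  #|[set p : 'I_k | (i < p)%N && (alpha_root i p x == 0)]|.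

Definition dminus (i : 'I_k) (x : lattice k) : nat :=
  #|[set p : 'I_k | (p < i)%N && (alpha_root p i x == 0)]|.

End Lattice.

Section LatticeFunctions.
Variables (F : fieldType) (k : nat).

Definition W_invariant (f : lattice k -> F) : Prop :=
  forall (w : 'S_k) (x : lattice k), f (weyl_act w^-1%g x) = f x.

(* The element of F(L)^W with prescribed values on L_+; see W_extendP. *)
Definition W_extend (g : lattice k -> F) (x : lattice k) : F :=
  g (dominant_rep x).

Definition Xhat (i : 'I_k) (f : lattice k -> F) (x : lattice k) : F :=
  f (x - basisv i).

Definition delta_eq (j : seq 'I_k) (x : lattice k) : F :=
  (constant [seq epsilon i x | i <- j])%:R.

Definition increasing_tuple r (j : r.-tuple 'I_k) : bool :=
  sorted ltn [seq val i | i <- j].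

(* The sum over 1 <= r <= k is indexed by s = r - 1; thead j is j_1.
   The truncated subtractions below are exact wherever delta_eq j x is
   nonzero. *)
Definition hamiltonian (alpha beta gamma delta q : F)
    (f : lattice k -> F) (x : lattice k) : F :=
  - (alpha * gamma)
    * (\sum_(j < k) qint q (dplus j x)
         / (1 + beta * gamma * qint q (dplus j x))) * f x
  + \sum_(s < k) (- (beta * delta)) ^+ s * qfact q s *
      \sum_(j : s.+1.-tuple 'I_k | increasing_tuple j)
        q ^+ (\sum_(p < s.+1) dminus (tnth j p) x - (s.+1 * s)./2)%N
        * delta_eq j x
        / (\prod_(p < s.+1)
             (1 + beta * gamma
                  * qint q (dplus (thead j) x + dminus (thead j) x - p)%N))
        * foldr Xhat f j x.

(* The formula for Phi_p on L_+, as a function on all of L. *)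
Definition bethe_sum (alpha beta gamma delta : F) (p : 'I_k -> F)
    (x : lattice k) : F :=
  \sum_(sigma : 'S_k)
    (\prod_(i < k) \prod_(j < k | (i < j)%N)
       (1 + (alpha + beta * p (sigma j)) * (gamma + delta * p (sigma i))
            / (p (sigma j) - p (sigma i))))
    * \prod_(i < k) p (sigma i) ^ (- epsilon i x).

Definition Phi (alpha beta gamma delta : F) (p : 'I_k -> F) :
    lattice k -> F :=
  W_extend (bethe_sum alpha beta gamma delta p).

(* Nonvanishing of f is not required: Phi can be identically zero when q is a
   root of unity.  For k = 2, alpha = 1, beta = 0, gamma = -1, delta = 2 one
   has q = -1, and Phi = 0 for (p_1, p_2) = (2, -1). *)
Definition is_eigenfunction (T : (lattice k -> F) -> (lattice k -> F))
    (lambda : F) (f : lattice k -> F) : Prop :=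
  forall x, T f x = lambda * f x.

End LatticeFunctions.

Section DominantRep.
Variable k : nat.
Implicit Types x : lattice k.

Let coords x := [seq epsilon j x | j <- enum 'I_k].

Let ge_total : total (>=%R : rel int).
Proof. by move=> a b; exact: le_total. Qed.

Let ge_trans : transitive (>=%R : rel int).
Proof. by move=> b a c ab bc; exact: le_trans bc ab. Qed.

Let ge_anti : antisymmetric (>=%R : rel int).
Proof. by move=> a b /andP[/= ba ab]; apply/eqP; rewrite eq_le ba andbC. Qed.

Let size_coords x : size (coords x) = k.
Proof. by rewrite size_map size_enum_ord. Qed.

Let nth_coords x (i : 'I_k) : nth 0 (coords x) i = epsilon i x.
Proof. by rewrite (nth_map i) ?size_enum_ord // nth_ord_enum. Qed.

Lemma dominant_rep_dominant x : dominant (dominant_rep x).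
Proof.
move=> i j leij; rewrite /epsilon !mxE.
have := sort_sorted ge_total (coords x) => sx.
apply: (sorted_leq_nth ge_trans _ 0 sx) => //; first by move=> a; exact: lexx.
- by rewrite inE size_sort size_coords.
- by rewrite inE size_sort size_coords.
Qed.

Lemma dominant_rep_id x : dominant x -> dominant_rep x = x.
Proof.
move=> dx; apply/rowP => i; rewrite mxE -/(coords x).
suff sx : sorted >=%R (coords x) by rewrite (sorted_sort ge_trans sx) nth_coords.
apply/(sortedP 0) => a; rewrite size_coords => lta.
have lta' := ltnW lta.
have := dx (Ordinal lta') (Ordinal lta) (leqnSn a).
by rewrite -!nth_coords.
Qed.

Lemma dominant_rep_weyl (w : 'S_k) x : dominant_rep (weyl_act w x) = dominant_rep x.
Proof.
apply/rowP => i; rewrite !mxE; congr (nth _ _ _).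
apply/(perm_sortP ge_total ge_trans ge_anti).
rewrite (eq_map (g := (fun j => epsilon j x) \o (w^-1)%g)); last by move=> j; rewrite /epsilon mxE.
rewrite map_comp; apply: perm_map; apply: uniq_perm.
- by rewrite map_inj_uniq ?enum_uniq //; exact: perm_inj.
- exact: enum_uniq.
move=> j; rewrite mem_enum; apply/mapP; exists (w j); first by rewrite mem_enum.
by rewrite permK.
Qed.

Lemma dominant_rep_orbit x : exists w : 'S_k, dominant_rep x = weyl_act w x.
Proof.
have sz : size (sort >=%R (coords x)) = k by rewrite size_sort size_coords.
have szP : size (sort >=%R (coords x)) == k by rewrite sz.
have szQ : size (coords x) == k by rewrite size_coords.
have : perm_eq (Tuple szP) (Tuple szQ) by rewrite perm_sort.
case/tuple_permP => w Ew; exists w^-1%g.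
apply/rowP => i; rewrite !mxE invgK -nth_coords -/(coords x).
rewrite [sort _ _]Ew (nth_map i) ?size_enum_ord // nth_ord_enum.
by rewrite (tnth_nth 0).
Qed.

End DominantRep.

(* W_extend g is the one and only W-invariant function agreeing with g on L_+. *)
Lemma W_extendP (F : fieldType) k (g f : lattice k -> F) :
  (W_invariant f /\ forall x, dominant x -> f x = g x) <-> f =1 W_extend g.
Proof.
split=> [[fW fg] x | fE].
  rewrite /W_extend -fg; last exact: dominant_rep_dominant.
  have [w ->] := dominant_rep_orbit x.
  by rewrite -[w]invgK fW.
split=> [w x | x dx]; rewrite !fE /W_extend.
  by rewrite dominant_rep_weyl.
by rewrite dominant_rep_id.
Qed.

(* Main.v *)
(** Split the coordinates of [x] into the levels on which they are constant,
    and let [z_t] be the [t]-th permuted parameter. As [Phi] is symmetric, the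
    action of the Hamiltonian at [x] depends only on the sizes of the levels:
    summing the powers of [q] over the subsets of a level gives [q]-binomials,
    and the shifts become products of the last variables [z_t] of the level.
    What remains is an identity under [sum_s A_s h(s)], with [A_s] the product
    of the two-body factors. If [h] is
    [z_a - z_(a+1) + (alpha + beta z_a) (gamma + delta z_(a+1))] times a
    function symmetric in [z_a] and [z_(a+1)], this sum vanishes by
    antisymmetry. It then vanishes also for
    [z_a - z_(a+n) + [n] (alpha + beta z_a) (gamma + delta z_(a+n))] times a
    function symmetric in [z_a, ..., z_(a+n)]. Solving recursively for [z_a]
    expresses it through products of the last variables, and summing these
    expressions over the variables of a level yields the coefficients of the
    Hamiltonian. *)

Require Import Defs.
From HB Require Import structures.
From mathcomp Require Import all_boot all_order all_fingroup all_algebra.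
From mathcomp Require Import complex reals.
From mathcomp Require Import ring zify.

Set Implicit Arguments.
Unset Strict Implicit.
Unset Printing Implicit Defensive.
Import Order.TTheory GRing.Theory Num.Theory.
Local Open Scope ring_scope.
Local Open Scope complex_scope.

(** * Gaussian binomial coefficients without division *)

Section QBinomial.
Variables (F : fieldType) (q : F).

Lemma qint0 : qint q 0 = 0.
Proof. by rewrite /qint big_ord0. Qed.

Lemma qintSr n : qint q n.+1 = qint q n + q ^+ n.
Proof. by rewrite /qint big_ord_recr. Qed.

Lemma qintS n : qint q n.+1 = 1 + q * qint q n.
Proof.
rewrite /qint big_ord_recl expr0 mulr_sumr; congr (_ + _).
by apply: eq_bigr => i _; rewrite exprS.
Qed.

Lemma qint1 : qint q 1 = 1.
Proof. by rewrite qintSr qint0 add0r. Qed.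

Lemma qintD m n : qint q (m + n) = qint q m + q ^+ m * qint q n.
Proof.
elim: n => [|n IH]; first by rewrite addn0 qint0 mulr0 addr0.
by rewrite addnS !qintSr IH exprD; ring.
Qed.

Lemma qfactS n : qfact q n.+1 = qfact q n * qint q n.+1.
Proof. by rewrite /qfact big_nat_recr. Qed.

(** The Gaussian binomial, given by its Pascal rule because [qfact q r] may vanish when [q] is a
    root of unity. The subtraction truncates only where the accompanying binomial is zero. *)
Fixpoint qbinom (m r : nat) : F :=
  match m, r with
  | _, 0 => 1
  | 0, _.+1 => 0
  | m'.+1, r'.+1 => qbinom m' r + q ^+ (m' - r') * qbinom m' r'
  end.

Lemma qbinom0 m : qbinom m 0 = 1.
Proof. by case: m. Qed.

Lemma qbinomS m r :
  qbinom m.+1 r.+1 = qbinom m r.+1 + q ^+ (m - r) * qbinom m r.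
Proof. by []. Qed.

Lemma qbinom_small m r : (m < r)%N -> qbinom m r = 0.
Proof.
elim: m r => [|m IH] [|r] //= lt_mr.
by rewrite !IH ?mulr0 ?addr0 //; lia.
Qed.

(** The Pascal rule reduces this to [[m+1] = [m-r] + q^(m-r) [r+1]]. For [r > m] the product
    contains the factor [[0] = 0]. *)
Lemma qbinom_ffact m r : qbinom m r * qfact q r = \prod_(t < r) qint q (m - t).
Proof.
elim: m r => [|m IH] [|r] /=; rewrite ?big_ord0 ?mul1r /qfact ?big_nil //.
  by rewrite mul0r big_ord_recl qint0 mul0r.
rewrite -/(qfact q r.+1) mulrDl IH -mulrA qfactS (mulrA (qbinom m r)) IH.
rewrite big_ord_recr big_ord_recl subn0 /=.
under [in RHS]eq_bigr => i _ do rewrite /bump add1n subSS.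
have [le_rm|lt_mr] := leqP r m; last first.
  have -> : \prod_(t < r) qint q (m - t) = 0.
    by rewrite (bigD1 (Ordinal lt_mr)) //= subnn qint0 mul0r.
  by rewrite !(mul0r, mulr0) addr0.
have -> : m.+1 = (m - r + r.+1)%N by lia.
by rewrite qintD; ring.
Qed.

(** This cannot be read off from [qbinom_ffact], since [qfact q r] need not be invertible; hence an
    induction along the Pascal rule. *)
Lemma qbinom_absorb m r :
  qbinom m r.+1 * qint q r.+1 = qbinom m r * qint q (m - r).
Proof.
elim: m r => [|m IH] [|r]; rewrite ?qint0 ?qbinom0 ?mul0r ?mulr0 //.
  by rewrite qbinomS mulrDl IH !qbinom0 !subn0 qint1 qintSr !mul1r !mulr1.
have [le_rm|lt_mr] := leqP r.+1 m; last first.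
  rewrite [qbinom m.+1 _]qbinom_small ?mul0r //.
  have -> : (m.+1 - r.+1 = 0)%N by lia.
  by rewrite qint0 mulr0.
rewrite subSS !qbinomS !mulrDl.
rewrite IH -(mulrA _ (qbinom m r)).
have -> : (m - r = (m - r.+1).+1)%N by lia.
have Er := IH r; move: Er.
have -> : (m - r = (m - r.+1).+1)%N by lia.
move=> Er; rewrite -Er (qintS r.+1) (qintSr (m - r.+1)) (exprS q (m - r.+1)).
by ring.
Qed.

End QBinomial.

Arguments qbinom {F} q m r : simpl never.

(** * Coefficients of the relations within a level *)

Section Coefficients.
Variables (F : fieldType) (alpha beta gamma delta q : F).
Hypothesis q_def : q = 1 + beta * gamma - alpha * delta.

Definition den (n : nat) : F := 1 + beta * gamma * qint q n.

(** With [step_coef], the coefficients of the recursion that solves for the first of [n + 1]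
    variables; for [n = 0] that variable is itself the last one, whence the value 1. *)
Definition head_coef (n : nat) : F :=
  if n is m.+1 then (1 - alpha * delta) * q ^+ m / (den m * den n) else 1.

Definition step_coef (n : nat) : F := - (beta * delta) * qint q n / den n.

Fixpoint tail_coef (n s : nat) : F :=
  if s is s'.+1 then step_coef n * tail_coef n.-1 s' else head_coef n.

(* The coefficient of the product of the last [s + 1] variables of a level of
   size [m]. *)
Definition cluster_coef (m s : nat) : F :=
  (- (beta * delta)) ^+ s * qfact q s * qbinom q m s.+1
    / \prod_(p < s.+1) den (m.-1 - p).

Lemma den0 : den 0 = 1.
Proof. by rewrite /den qint0 mulr0 addr0. Qed.

Hypothesis den_neq0 : forall n, den n != 0.

(** Multiplied by [den n], both sides equal [(1 - alpha delta) q^n]. The right-hand side is the form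
    in which this coefficient arises when the first variable is eliminated. *)
Lemma head_coefS n :
  den n.+1 * head_coef n.+1
  = 1 - alpha * delta * qint q n.+1
    + beta * delta * alpha * gamma * qint q n.+1 * qint q n / den n.
Proof.
have nz := den_neq0 n; have nz1 := den_neq0 n.+1.
have Eq : q ^+ n = 1 + (q - 1) * qint q n.
  by have := qintS q n; rewrite qintSr => /(canRL (addKr _)) ->; ring.
apply: (mulIf nz); transitivity ((1 - alpha * delta) * q ^+ n).
  by rewrite /head_coef; field; rewrite nz nz1.
transitivity ((1 - alpha * delta * qint q n.+1) * den n
    + beta * delta * alpha * gamma * qint q n.+1 * qint q n); last by field.
by rewrite /den qintS Eq q_def; ring.
Qed.

Lemma tail_coefE n s : (s <= n)%N ->
  tail_coef n s = (- (beta * delta)) ^+ s * (\prod_(t < s) qint q (n - t))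
                  * head_coef (n - s) / \prod_(t < s) den (n - t).
Proof.
elim: s n => [|s IH] n le_sn.
  by rewrite !big_ord0 subn0 expr0 !mul1r divr1.
case: n le_sn => // n le_sn; rewrite /= IH // subSS.
rewrite !(big_ord_recl s) /= subn0.
under [X in _ = _ * (_ * X) * _ / _]eq_bigr => i _ do rewrite /bump add1n subSS.
under [X in _ = _ / (_ * X)]eq_bigr => i _ do rewrite /bump add1n subSS.
have nz : \prod_(t < s) den (n - t) != 0 by apply/prodf_neq0 => i _.
rewrite exprS /step_coef; field; by rewrite nz den_neq0.
Qed.

Lemma cluster_coef_small m s : (m <= s)%N -> cluster_coef m s = 0.
Proof. by move=> le_ms; rewrite /cluster_coef qbinom_small // mulr0 mul0r. Qed.

(** Prepending a variable to a level of size [m] adds the coefficients of the expression for that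
    variable. After clearing denominators this is a Pascal rule weighted by values of [den]. *)
Lemma cluster_coefS m s : (s <= m)%N ->
  cluster_coef m.+1 s = cluster_coef m s + tail_coef m s.
Proof.
move=> le_sm; rewrite tail_coefE // /cluster_coef -qbinom_ffact.
move: le_sm; rewrite leq_eqVlt => /orP[/eqP->|lt_sm].
  rewrite qbinomS [qbinom q m m.+1]qbinom_small // subnn.
  rewrite big_ord_recr /= subnn den0 !mulr1.
  by rewrite expr0 mulr0 mul0r; ring.
(* With this form of [m] the truncated subtractions become exact. *)
have [n Em] : exists n, m = (n + s).+1 by exists (m - s.+1)%N; lia.
have nz : \prod_(t < s) den (n + s - t) != 0 by apply/prodf_neq0 => i _.
rewrite {lt_sm}Em /=.
have -> : \prod_(p < s.+1) den ((n + s).+1 - p)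
   = den (n + s).+1 * \prod_(t < s) den (n + s - t).
  by rewrite big_ord_recl subn0; congr (_ * _).
have -> : \prod_(t < s) den ((n + s).+1 - t)
   = den (n + s).+1 * \prod_(t < s) den (n + s - t) / den n.+1.
  apply: (mulIf (den_neq0 n.+1)); rewrite mulfVK //.
  have -> : den n.+1 = den ((n + s).+1 - s) by congr den; lia.
  rewrite -(big_ord_recr s (fun t => den ((n + s).+1 - t))) /=.
  by rewrite big_ord_recl subn0; congr (_ * _).
rewrite big_ord_recr /= addnK.
have -> : ((n + s).+1 - s = n.+1)%N by lia.
rewrite /head_coef qbinomS.
have nzm := den_neq0 (n + s).+1; have nzn := den_neq0 n; have nz1 := den_neq0 n.+1.
have Ab := qbinom_absorb q (n + s).+1 s.
have En : ((n + s).+1 - s = n.+1)%N by lia.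
rewrite En in Ab *.
have D1 : den (n + s).+1 = den n + beta * gamma * q ^+ n * qint q s.+1.
  by rewrite /den -addnS qintD; ring.
have D2 : q * den n - beta * gamma * qint q n.+1 = 1 - alpha * delta.
  by rewrite /den qintS q_def; ring.
set P := \prod_(t < s) _ in nz *; set f := qfact q s; set x := (- _) ^+ s.
set b1 := qbinom q _ s.+1 in Ab *; set b := qbinom q _ s in Ab *.
(* By [D1] and [D2] the two sides differ by a multiple of [b1 [s+1] - b [n+1]], which vanishes by
   absorption. *)
have Key : (b1 + q ^+ n.+1 * b) * den n
    = b1 * den (n + s).+1 + b * q ^+ n * (1 - alpha * delta).
  rewrite D1 -D2 exprS.
  transitivity (b1 * den n + beta * gamma * q ^+ n * (b1 * qint q s.+1)
    + b * q ^+ n * (q * den n - beta * gamma * qint q n.+1)); last by ring.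
  by rewrite Ab; ring.
apply: (mulIf (mulf_neq0 (mulf_neq0 nzm nz) nzn)).
transitivity (x * f * ((b1 + q ^+ n.+1 * b) * den n)).
  by field; rewrite nzm nz.
by rewrite Key; field; rewrite nz nzm nzn nz1.
Qed.

End Coefficients.

(** * Functions whose sum against the two-body factors vanishes *)

Section BetheNull.
Variables (F : fieldType) (alpha beta gamma delta q : F) (k : nat).
Variable p : 'I_k.+1 -> F.
Hypothesis q_def : q = 1 + beta * gamma - alpha * delta.
Hypothesis p_inj : injective p.

Implicit Types (s : 'S_k.+1) (g h : 'S_k.+1 -> F).

Definition scat (a b : F) : F :=
  1 + (alpha + beta * b) * (gamma + delta * a) / (b - a).

Definition bethe_coef s : F :=
  \prod_(i < k.+1) \prod_(j < k.+1 | (i < j)%N) scat (p (s i)) (p (s j)).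

(** The variable [z_n], indexed by natural numbers so that blocks are intervals. [inord] sends
    indices above [k] to 0, hence the bounds carried by later lemmas. *)
Definition bvar n s : F := p (s (inord n)).

Definition adj n : 'S_k.+1 := tperm (inord n) (inord n.+1).

(** Symmetry in [z_a, ..., z_(b-1)], stated on generators: left multiplication by [adj i] exchanges
    [z_i] and [z_(i+1)]. *)
Definition block_sym (a b : nat) g : Prop :=
  forall i, (a <= i)%N -> (i.+1 < b)%N -> forall s, g (adj i * s)%g = g s.

Definition bethe_null h : Prop := \sum_s bethe_coef s * h s = 0.

Lemma adjE n i : (n < k)%N ->
  adj n i = (if i == n :> nat then n.+1 else if i == n.+1 :> nat then n else i) :> nat.
Proof.
move=> lt_nk; have lt_nk' := ltnW lt_nk.
have E m : (m <= k)%N -> (i == inord m) = (i == m :> nat).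
  by move=> le_mk; rewrite -(inj_eq (@ord_inj k.+1)) inordK.
rewrite permE /= !E //.
by case: eqP => _; [|case: eqP => _]; rewrite /= ?inordK.
Qed.

Lemma bvar_adj n m s : bvar m (adj n * s)%g = p (s (adj n (inord m))).
Proof. by rewrite /bvar permM. Qed.

Lemma bvar_adj_id n m s : (m <= k)%N -> (n < k)%N -> m != n -> m != n.+1 ->
  bvar m (adj n * s)%g = bvar m s.
Proof.
move=> le_mk lt_nk /negbTE nm /negbTE nm1; rewrite bvar_adj; congr (p (s _)).
by apply: ord_inj; rewrite adjE // inordK // nm nm1.
Qed.

Lemma bvar_adjl n s : bvar n (adj n * s)%g = bvar n.+1 s.
Proof. by rewrite bvar_adj tpermL. Qed.

Lemma bvar_adjr n s : bvar n.+1 (adj n * s)%g = bvar n s.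
Proof. by rewrite bvar_adj tpermR. Qed.

Lemma bvar_neq m n s : (m <= k)%N -> (n <= k)%N -> m != n ->
  bvar m s != bvar n s.
Proof.
move=> le_mk le_nk; apply: contra => /eqP/p_inj/perm_inj/(congr1 (@nat_of_ord k.+1)).
by rewrite !inordK // => ->.
Qed.

(** Exchanging positions [n] and [n + 1] permutes the ordered pairs other than [(n, n+1)] among
    themselves, so [B] is the product over those pairs. *)
Lemma bethe_coef_adj n : (n < k)%N ->
  exists2 B : 'S_k.+1 -> F,
    forall s, bethe_coef s = scat (bvar n s) (bvar n.+1 s) * B s
  & forall s, B (adj n * s)%g = B s.
Proof.
move=> lt_nk; pose u0 : 'I_k.+1 * 'I_k.+1 := (inord n, inord n.+1).
exists (fun s => \prod_(u : 'I_k.+1 * 'I_k.+1 | (u.1 < u.2)%N && (u != u0))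
    scat (p (s u.1)) (p (s u.2))) => s.
  rewrite /bethe_coef pair_big_dep /= (bigD1 u0) //= !inordK ?ltnS //.
  by apply: ltnW.
pose h (u : 'I_k.+1 * 'I_k.+1) := (adj n u.1, adj n u.2).
have hK : involutive h by case=> i j; rewrite /h /= /adj !tpermK.
rewrite [RHS](reindex_inj (inv_inj hK)) /=; apply: eq_big; last first.
  by move=> u _; rewrite !permM.
have lt_nk' := ltnW lt_nk; case=> i j; rewrite /h /= !xpair_eqE.
rewrite -!(inj_eq (@ord_inj k.+1)) !adjE // !inordK ?ltnS //.
move: (nat_of_ord i) (nat_of_ord j) => x y.
by case: (eqVneq x n) => ?; case: (eqVneq x n.+1) => ?;
  case: (eqVneq y n) => ?; case: (eqVneq y n.+1) => ?; lia.
Qed.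

(** Left multiplication by [adj n] matches odd with even permutations. Splitting by parity, rather
    than showing that twice the sum is zero, also covers characteristic 2. *)
Lemma sum_adj_anti n h : (n < k)%N ->
  (forall s, h (adj n * s)%g = - h s) -> \sum_s h s = 0.
Proof.
move=> lt_nk hN; rewrite (bigID (fun s => odd_perm s)) /=.
rewrite (reindex_inj (mulgI (adj n))) /=.
rewrite [X in X + _](eq_big (fun s => ~~ odd_perm s) (fun s => - h s)) //; last first.
  move=> s; rewrite odd_mul_tperm -(inj_eq (@ord_inj k.+1)).
  by rewrite !inordK ?ltnS ?(ltnW lt_nk) // neq_ltn ltnSn.
by rewrite sumrN addNr.
Qed.

(** The given factor is the numerator of [scat] with its two variables exchanged. Their product is
    symmetric, and the remaining denominator [z_(n+1) - z_n] makes the summand antisymmetric. *)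
Lemma bethe_null_adjacent n g : (n < k)%N -> block_sym n n.+2 g ->
  bethe_null (fun s => (bvar n s - bvar n.+1 s
    + (alpha + beta * bvar n s) * (gamma + delta * bvar n.+1 s)) * g s).
Proof.
move=> lt_nk gS; have [B BE BS] := bethe_coef_adj lt_nk.
apply: (sum_adj_anti lt_nk) => s.
have neq : bvar n.+1 s - bvar n s != 0.
  by rewrite subr_eq0; apply: bvar_neq; lia.
have neq' : bvar n s - bvar n.+1 s != 0 by rewrite -opprB oppr_eq0.
rewrite !BE BS !bvar_adjl !bvar_adjr gS // /scat; field.
by rewrite neq neq'.
Qed.

Lemma bethe_null_ext h h' : h =1 h' -> bethe_null h -> bethe_null h'.
Proof. move=> hh' h0; rewrite /bethe_null -[RHS]h0.
by apply: eq_bigr => s _; rewrite hh'. Qed.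

Lemma bethe_nullD h h' : bethe_null h -> bethe_null h' ->
  bethe_null (fun s => h s + h' s).
Proof.
rewrite /bethe_null => h0 h0'; under eq_bigr do rewrite mulrDr.
by rewrite big_split /= h0 h0' addr0.
Qed.

Lemma bethe_nullZ c h : bethe_null h -> bethe_null (fun s => c * h s).
Proof.
rewrite /bethe_null => h0; under eq_bigr do rewrite mulrCA.
by rewrite -mulr_sumr h0 mulr0.
Qed.

Lemma block_sym_sub a b a' b' g : (a <= a')%N -> (b' <= b)%N ->
  block_sym a b g -> block_sym a' b' g.
Proof.
move=> le_a le_b gS i le_i lt_i.
by apply: gS; [apply: leq_trans le_i | apply: leq_trans le_b].
Qed.

Lemma block_symM a b g h : block_sym a b g -> block_sym a b h ->
  block_sym a b (fun s => g s * h s).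
Proof. by move=> gS hS i le_i lt_i s; rewrite gS // hS. Qed.

Lemma block_sym_bvar a b f n : (b <= k.+1)%N -> (n < a)%N || (b <= n <= k)%N ->
  block_sym a b (fun s => f (bvar n s)).
Proof.
by move=> le_b n_out i le_i lt_i s; rewrite bvar_adj_id //; lia.
Qed.

(* The relation for a gap [n] interpolates the adjacent one: it is the
   combination of the relations for the gaps [n - 1] and [1] in which the
   intermediate variable cancels. *)
Lemma bethe_null_gap a n g : (0 < n)%N -> (a + n <= k)%N ->
  block_sym a (a + n).+1 g ->
  bethe_null (fun s => (bvar a s - bvar (a + n) s + qint q n
    * (alpha + beta * bvar a s) * (gamma + delta * bvar (a + n) s)) * g s).
Proof.
case: n => // n _; elim: n g => [|n IH] g le_k gS.
  rewrite addn1 in le_k gS *.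
  apply: bethe_null_ext (bethe_null_adjacent le_k gS) => s.
  by rewrite qint1; ring.
(* [l] is the coefficient of the middle variable in the adjacent relation, and [m] is minus its
   coefficient in the shorter gap relation, so it cancels in the combination. [l] involves only the
   last variable and [m] only the first, both outside the block where symmetry is required. *)
pose l s := 1 + beta * (gamma + delta * bvar (a + n.+2) s).
pose m s := 1 - qint q n.+1 * delta * (alpha + beta * bvar a s).
have gl : block_sym a (a + n.+1).+1 (fun s => g s * l s).
  apply: block_symM; first by apply: block_sym_sub gS => //; lia.
  apply: (@block_sym_bvar _ _ (fun x => 1 + beta * (gamma + delta * x))); lia.
have gm : block_sym (a + n.+1) (a + n.+1).+2 (fun s => g s * m s).
  apply: block_symM; first by apply: block_sym_sub gS => //; lia.
  apply: (@block_sym_bvar _ _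
    (fun x => 1 - qint q n.+1 * delta * (alpha + beta * x))); lia.
have le_k1 : (a + n.+1 <= k)%N by lia.
have lt_k : (a + n.+1 < k)%N by lia.
have := bethe_nullD (IH _ le_k1 gl) (bethe_null_adjacent lt_k gm).
apply: bethe_null_ext => s; rewrite /l /m !addnS (qintS q n.+1) q_def.
by ring.
Qed.

Hypothesis den_neq0 : forall n, den beta gamma q n != 0.

Local Notation den := (den beta gamma q).
Local Notation tail_coef := (tail_coef alpha beta gamma delta q).
Local Notation cluster_coef := (cluster_coef beta gamma delta q).

Definition bvar_prod a b s : F := \prod_(a <= t < b) bvar t s.

(** Up to the constant [alpha gamma [n] / den n], the expression replacing [z_a] by products of the
    last variables of [z_a, ..., z_(a+n)]. *)
Definition tail_sum n a s : F :=
  \sum_(r < n.+1) tail_coef n r * bvar_prod (a + n - r) (a + n).+1 s.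

Lemma tail_sumS n a s :
  tail_sum n.+1 a s = bvar (a + n.+1) s
    * (head_coef alpha beta gamma delta q n.+1
       + step_coef beta gamma delta q n.+1 * tail_sum n a s).
Proof.
rewrite /tail_sum big_ord_recl mulrDr; congr (_ + _).
  by rewrite subn0 /bvar_prod big_nat1 /= mulrC.
rewrite mulrA mulr_sumr; apply: eq_bigr => r _.
rewrite /= /bump add1n addnS subSS /bvar_prod big_nat_recr /=; last by lia.
by ring.
Qed.

(** The gap relation divided by [den n.+1] gives [z_a] up to a term in [z_a z_(a+n+1)]. There [z_a]
    is replaced by induction, the factor [z_(a+n+1)] being outside the shorter block. *)
Lemma bethe_null_tail a n g : (a + n <= k)%N -> block_sym a (a + n).+1 g ->
  bethe_null (fun s => (bvar a s - tail_sum n a s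
    + alpha * gamma * (qint q n / den n)) * g s).
Proof.
elim: n g => [|n IH] g le_k gS.
  rewrite /bethe_null big1 // => s _; rewrite /tail_sum big_ord1 !addn0 subn0.
  by rewrite /bvar_prod big_nat1 qint0 mul0r /=; ring.
have le_k1 : (a + n <= k)%N by lia.
have gS1 : block_sym a (a + n).+1 (fun s => g s * bvar (a + n.+1) s).
  apply: block_symM; first by apply: block_sym_sub gS => //; lia.
  by apply: (@block_sym_bvar _ _ id); lia.
have := bethe_nullD (bethe_nullZ (den n.+1)^-1 (bethe_null_gap (ltn0Sn n) le_k gS))
  (bethe_nullZ (step_coef beta gamma delta q n.+1) (IH _ le_k1 gS1)).
apply: bethe_null_ext => s; rewrite tail_sumS.
have nz := den_neq0 n; have nz1 := den_neq0 n.+1.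
have := head_coefS q_def den_neq0 n.
set f := head_coef _ _ _ _ _ _ => fE; rewrite /step_coef.
have -> : f = (1 - alpha * delta * qint q n.+1
    + beta * delta * alpha * gamma * qint q n.+1 * qint q n / den n) / den n.+1.
  by rewrite -fE mulrC mulKf.
(* This exposes the coefficient of [z_a] in the gap relation; the denominators can then be treated
   as independent quantities. *)
have zE : bvar a s = (1 + beta * gamma * qint q n.+1) * bvar a s / den n.+1.
  by rewrite mulrAC divff // mul1r.
rewrite [in RHS]zE.
move: (tail_sum n a s) (bvar a s) (bvar (a + n.+1) s) (g s) nz nz1 => T x y c.
move: (den n) (den n.+1) => d d1 nz nz1.
by field; rewrite nz nz1.
Qed.

(** The multiplier by which the Hamiltonian acts through one level, of size [m] and starting at
    position [a]. *)
Definition cluster_sum m a s : F :=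
  \sum_(r < m) cluster_coef m r * bvar_prod (a + m - r.+1) (a + m) s
  - alpha * gamma * \sum_(d < m) qint q d / den d.

(** Products of last variables depend only on where the level ends, so prepending [z_a] changes only
    their coefficients. *)
Lemma cluster_sumS m a s : cluster_sum m.+1 a s =
  cluster_sum m a.+1 s + tail_sum m a s - alpha * gamma * (qint q m / den m).
Proof.
rewrite /cluster_sum 2!big_ord_recr /=.
rewrite /tail_sum big_ord_recr /=.
rewrite (cluster_coefS q_def den_neq0) // cluster_coef_small // add0r.
rewrite (eq_bigr (fun r : 'I_m =>
    cluster_coef m r * bvar_prod (a.+1 + m - r.+1) (a.+1 + m) s
  + tail_coef m r * bvar_prod (a + m - r) (a + m).+1 s)); last first.
  move=> r _; rewrite (cluster_coefS q_def den_neq0) //; last exact: ltnW.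
  by rewrite addSn addnS subSS mulrDl.
by rewrite big_split /= addnS subSS; ring.
Qed.

(** The variables of the level are peeled off from the left, each contributing its tail relation. *)
Lemma bethe_null_cluster m a g : (a + m <= k.+1)%N -> block_sym a (a + m) g ->
  bethe_null (fun s => (cluster_sum m a s - \sum_(a <= t < a + m) bvar t s) * g s).
Proof.
elim: m a => [|m IH] a le_k gS.
  rewrite /bethe_null big1 // => s _.
  by rewrite /cluster_sum !big_ord0 addn0 big_geq //; ring.
have le_k1 : (a.+1 + m <= k.+1)%N by lia.
have le_k2 : (a + m <= k)%N by lia.
have gS1 : block_sym a.+1 (a.+1 + m) g by apply: block_sym_sub gS; lia.
have gS2 : block_sym a (a + m).+1 g by apply: block_sym_sub gS; lia.
have := bethe_nullD (IH _ le_k1 gS1) (bethe_nullZ (- 1) (bethe_null_tail le_k2 gS2)).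
apply: bethe_null_ext => s.
by rewrite cluster_sumS addSn addnS [in RHS]big_ltn ?ltnS ?leq_addr //; ring.
Qed.

End BetheNull.

(** * Ranks in a finite set and the subset formula for Gaussian binomials *)

Section Ranks.
Variable k : nat.
Implicit Types (A J : {set 'I_k}) (i m : 'I_k).

Definition rank A i : nat := #|[set l in A | (l < i)%N]|.

Lemma set_max A : A != set0 ->
  exists2 m, m \in A & forall i, i \in A -> (i <= m)%N.
Proof.
case/set0Pn=> i0 Ai0; case: (arg_maxnP (fun i : 'I_k => i : nat) Ai0) => m Am mP.
by exists m.
Qed.

Lemma rank_max A m : m \in A -> (forall i, i \in A -> (i <= m)%N) ->
  rank A m = #|A :\ m|.
Proof.
move=> Am mP; apply: eq_card => i; rewrite !inE andbC.
case: (boolP (i \in A)) => [/mP le_im|]; last by rewrite !andbF.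
by rewrite !andbT ltn_neqAle le_im andbT.
Qed.

Lemma rank_setD1 A m i : (i <= m)%N -> rank (A :\ m) i = rank A i.
Proof.
move=> le_im; apply: eq_card => l; rewrite !inE.
case: eqVneq => [->|] //=; by rewrite ltnNge le_im andbF.
Qed.

Lemma big_rank (T : Type) (idx : T) (op : Monoid.com_law idx) A (f : nat -> T) :
  \big[op/idx]_(i in A) f (rank A i) = \big[op/idx]_(d < #|A|) f d.
Proof.
move: {2}#|A| (leqnn #|A|) => n; elim: n A => [|n IH] A.
  by rewrite leqn0 cards_eq0 => /eqP->; rewrite big_set0 cards0 big_ord0.
have [->|A0] := eqVneq A set0; first by rewrite big_set0 cards0 big_ord0.
have [m Am mP] := set_max A0; rewrite (cardsD1 m A) Am add1n ltnS => le_n.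
rewrite (bigD1 m) //= rank_max // big_ord_recr /= Monoid.mulmC; congr (op _ _).
rewrite -IH //; apply: eq_big => [i|i /andP[Ai _]]; first by rewrite !inE andbC.
by rewrite rank_setD1 // mP.
Qed.

(** Ranks in [A] dominate ranks in [J], and the latter are [0, ..., #|J| - 1]. This makes the
    subtraction in the exponent of [q] exact. *)
Lemma leq_sum_rank A J : J \subset A ->
  ((#|J| * #|J|.-1)./2 <= \sum_(i in J) rank A i)%N.
Proof.
move=> sJA; rewrite -bin2 -triangular_sum big_mkord -(big_rank _ J (fun d => d)).
apply: leq_sum => i _; apply: subset_leq_card; apply/subsetP => l.
by rewrite !inE => /andP[/(subsetP sJA)-> ->].
Qed.

(** Splitting the subsets by whether they contain the maximum of [A] reproduces the Pascal rule: the
    maximum has rank [#|A| - 1], while the subtracted triangular number grows by [r]. *)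
Lemma sum_rank_qbinom (F : fieldType) (q : F) A r :
  \sum_(J : {set 'I_k} | (J \subset A) && (#|J| == r))
     q ^+ (\sum_(i in J) rank A i - (r * r.-1)./2)
  = qbinom q #|A| r.
Proof.
move: {2}#|A| (leqnn #|A|) => n; elim: n A r => [|n IH] A r le_n.
  move: le_n; rewrite leqn0 cards_eq0 => /eqP->; rewrite cards0.
  case: r => [|r].
    rewrite (big_pred1 set0) ?big_set0 ?qbinom0 ?expr0 // => J.
    by rewrite /= cards_eq0 subset0 andbb.
  rewrite big_pred0 // => J; rewrite subset0; apply/negP => /andP[/eqP->].
  by rewrite cards0.
have [A0|A0] := eqVneq A set0; first by apply: IH; rewrite A0 cards0.
have [m Am mP] := set_max A0.
have Ac := cardsD1 m A; rewrite Am add1n in Ac.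
have le_n' : (#|A :\ m| <= n)%N by rewrite Ac ltnS in le_n.
case: r => [|r].
  rewrite (big_pred1 set0) ?big_set0 ?qbinom0 ?expr0 // => J /=.
  by rewrite cards_eq0; case: eqVneq => [->|]; rewrite ?sub0set ?andbF.
rewrite Ac qbinomS -!IH // (bigID (fun J : {set 'I_k} => m \in J)) /= addrC.
congr (_ + _).
  apply: eq_big => [J|J /andP[/andP[sJA _] mJ]].
    by rewrite subsetD1; case: (J \subset A); case: (m \in J); rewrite ?andbF ?andbT.
  congr (q ^+ (_ - _)); apply: eq_bigr => i Ji; rewrite rank_setD1 // mP //.
  exact: (subsetP sJA).
rewrite (reindex_onto (fun J => m |: J) (fun J => J :\ m)) /=; last first.
  by move=> J /andP[_ mJ]; rewrite setD1K.
rewrite mulr_sumr; apply: eq_big => [J|J].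
  rewrite setU11 andbT; have [mJ|mJ] := boolP (m \in J).
    rewrite subsetD1 mJ andbF; apply/negP => /andP[_ /eqP Jm].
    by have := setD11 m (m |: J); rewrite Jm mJ.
  rewrite setU1K // eqxx andbT cardsU1 mJ add1n eqSS subUset sub1set Am /=.
  by rewrite subsetD1 mJ andbT.
rewrite setU11 andbT => /andP[/andP[sJA /eqP Jc] /eqP Jm].
have mJ : m \notin J by rewrite -Jm setD11.
have {}Jc : #|J| = r by move: Jc; rewrite cardsU1 mJ => -[].
have sJ : J \subset A :\ m.
  by rewrite subsetD1 mJ andbT (subset_trans _ sJA) // subsetUr.
rewrite big_setU1 //= rank_max //.
have -> : (\sum_(i in J) rank A i = \sum_(i in J) rank (A :\ m) i)%N.
  apply: eq_bigr => i Ji; rewrite rank_setD1 // mP //.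
  by apply: (subsetP sJA); rewrite inE Ji orbT.
have := leq_sum_rank sJ; have := subset_leq_card sJ; rewrite Jc => le_r le_s.
rewrite -exprD; congr (q ^+ _).
have -> : ((r.+1 * r.+1.-1)./2 = (r * r.-1)./2 + r)%N.
  by rewrite -!bin2 binS bin1.
by move: (half _) (\sum_(i in J) _)%N #|_| le_r le_s => ? ? ?; lia.
Qed.

End Ranks.

(** * Increasing tuples as subsets *)

Section IncreasingTuples.
Variables (k n : nat).

Lemma sorted_enum_set (J : {set 'I_k}) : sorted ltn [seq val i | i <- enum J].
Proof.
have : sorted ltn [seq val i | i <- enum 'I_k] by rewrite val_enum_ord iota_ltn_sorted.
have -> : enum J = [seq i <- enum 'I_k | i \in J].
  by rewrite /enum_mem -filter_predI; apply: eq_filter => i; rewrite /= andbT.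
rewrite 2!sorted_map => Is; apply: (sorted_filter _ _ Is) => ? ? ?; exact: ltn_trans.
Qed.

Lemma increasing_tuple_uniq (j : n.-tuple 'I_k) : increasing_tuple j -> uniq j.
Proof.
by move/(sorted_uniq ltn_trans ltnn); rewrite map_inj_uniq //; apply: val_inj.
Qed.

Lemma sum_increasing_tuple (i0 : 'I_k) (V : nmodType) (P : pred {set 'I_k})
    (G : {set 'I_k} -> V) :
  \sum_(j : n.-tuple 'I_k | increasing_tuple j && P [set i in j]) G [set i in j]
  = \sum_(J : {set 'I_k} | P J && (#|J| == n)) G J.
Proof.
(* The constant tuple is a default for sets of the wrong cardinality, which do not occur in the
   sum. *)
pose tup (J : {set 'I_k}) : n.-tuple 'I_k := insubd (nseq_tuple n i0) (enum J).
have tupE (J : {set 'I_k}) : #|J| = n -> tup J = enum J :> seq 'I_k.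
  by move=> Jn; rewrite val_insubd -cardE Jn eqxx.
rewrite [RHS](reindex_onto (fun j : n.-tuple 'I_k => [set i in j]) tup) /=.
  apply: eq_bigl => j; apply/idP/idP => [/andP[jI ->]|/andP[/andP[-> /eqP cj] /eqP <-]].
    have cj : #|[set i in j]| = n.
      by rewrite cardsE (card_uniqP (increasing_tuple_uniq jI)) size_tuple.
    rewrite cj eqxx /= -val_eqE /= tupE //; apply/eqP/(inj_map val_inj).
    apply: (irr_sorted_eq ltn_trans ltnn (sorted_enum_set _) jI) => y.
    by apply/mapP/mapP => -[i ij ->]; exists i; rewrite // mem_enum inE in ij *.
  by rewrite andbT /increasing_tuple tupE ?sorted_enum_set.
by move=> J /andP[_ /eqP cJ]; apply/setP => i; rewrite inE -(mem_enum J) -tupE.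
Qed.

End IncreasingTuples.

Lemma big_ord_interval (T : Type) (idx : T) (op : Monoid.com_law idx) k a b
    (f : nat -> T) : (b <= k)%N ->
  \big[op/idx]_(i in [set i : 'I_k | (a <= i < b)%N]) f i
  = \big[op/idx]_(a <= t < b) f t.
Proof.
move=> le_b; rewrite big_geq_mkord (big_ord_widen_cond k (fun i => a <= i)%N) //.
by apply: eq_bigl => i; rewrite inE.
Qed.

Lemma card_ord_interval k a b : (b <= k)%N ->
  #|[set i : 'I_k | (a <= i < b)%N]| = (b - a)%N.
Proof.
move=> le_b; rewrite -sum1_card (big_ord_interval _ _ (fun=> 1%N)) //.
by rewrite sum_nat_const_nat muln1.
Qed.

(** * Levels of a lattice point and the effect of lowering coordinates *)

Section Levels.
Variable k : nat.
Implicit Types (x y : lattice k) (c t : int) (i : 'I_k) (J K : {set 'I_k}).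

Definition level c x : {set 'I_k} := [set i | epsilon i x == c].

Definition lower J x : lattice k := x - \sum_(i in J) basisv i.

Lemma epsilon_lower J x i : epsilon i (lower J x) = epsilon i x - (i \in J)%:R.
Proof.
rewrite /epsilon !mxE summxE; congr (_ - _).
rewrite (eq_bigr (fun l => (l == i)%:R)) => [|l _]; last by rewrite mxE eqxx eq_sym.
have [iJ|niJ] := boolP (i \in J).
  by rewrite (bigD1 i) //= eqxx big1 ?addr0 // => l /andP[_ /negbTE->].
by rewrite big1 // => l lJ; case: eqVneq lJ niJ => // -> ->.
Qed.

Lemma dminus_rank i x : dminus i x = rank (level (epsilon i x) x) i.
Proof.
by apply: eq_card => l; rewrite !inE /alpha_root subr_eq0 andbC.
Qed.

Lemma dplus_rank i x :
  dplus i x = (#|level (epsilon i x) x|.-1 - rank (level (epsilon i x) x) i)%N.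
Proof.
set A := level _ _; have Ai : i \in A by rewrite inE.
rewrite (cardsD1 i A) Ai add1n /= -(cardsID [set l : 'I_k | (l < i)%N] (A :\ i)) /=.
have -> : rank A i = #|(A :\ i) :&: [set l : 'I_k | (l < i)%N]|.
  apply: eq_card => l; rewrite !inE; case: (eqVneq l i) => [->|//].
  by rewrite ltnn andbF.
rewrite addKn; apply: eq_card => l; rewrite !inE /alpha_root subr_eq0.
have -> : (i < l)%N = (l != i) && ~~ (l < i)%N.
  by rewrite -leqNgt ltn_neqAle eq_sym.
by rewrite [epsilon i x == _]eq_sym -andbA andbCA.
Qed.

Lemma dplus_dminus i x :
  (dplus i x + dminus i x = #|level (epsilon i x) x|.-1)%N.
Proof.
rewrite dplus_rank dminus_rank subnK //; set A := level _ _.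
have Ai : i \in A by rewrite inE.
rewrite [#|A|](cardsD1 i) Ai add1n /=; apply: subset_leq_card.
apply/subsetP => l; rewrite !inE => /andP[-> lt_li]; rewrite andbT.
by apply: contraTneq lt_li => ->; rewrite ltnn.
Qed.

Lemma sum_dplus (V : nmodType) (f : nat -> V) c x :
  \sum_(i in level c x) f (dplus i x) = \sum_(d < #|level c x|) f d.
Proof.
rewrite (eq_bigr (fun i => f (#|level c x|.-1 - rank (level c x) i)%N)).
  rewrite (big_rank _ _ (fun d => f (_.-1 - d)%N)).
  rewrite (reindex_inj rev_ord_inj) /=; apply: eq_bigr => d _; congr f.
  by have := ltn_ord d; lia.
by move=> i; rewrite inE => /eqP <-; rewrite dplus_rank.
Qed.

Lemma card_level_lower J c t x : J \subset level c x ->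
  #|level t (lower J x)|
  = (#|level t x| - (t == c) * #|J| + (t == (c - 1)%R) * #|J|)%N.
Proof.
move=> sJ; have JP i : i \in J -> epsilon i x = c.
  by move=> /(subsetP sJ); rewrite inE => /eqP.
have [->|ntc] := eqVneq t c.
  have -> : (c == c - 1) = false by apply/negP => /eqP; lia.
  rewrite mul1n addn0 -(cardsDS sJ); apply: eq_card => i.
  rewrite !inE epsilon_lower; have [/JP->|_] := boolP (i \in J); last by rewrite subr0.
  by rewrite /= mulr1n; apply/negbTE/eqP; lia.
rewrite subn0; have [->|ntc1] := eqVneq t (c - 1).
  rewrite mul1n -[RHS]subn0; have <- : #|level (c - 1) x :&: J| = 0%N.
    apply/eqP; rewrite cards_eq0 -subset0; apply/subsetP => i.
    by rewrite !inE => /andP[/eqP xi /JP]; lia.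
  rewrite -cardsU; apply: eq_card => i; rewrite !inE epsilon_lower.
  have [/JP->|_] := boolP (i \in J); first by rewrite orbT mulr1n eqxx.
  by rewrite subr0 orbF.
rewrite addn0; apply: eq_card => i; rewrite !inE epsilon_lower.
have [/JP->|_] := boolP (i \in J); last by rewrite subr0.
rewrite mulr1n; apply/eqP/eqP => /= E; move/eqP: ntc; move/eqP: ntc1; lia.
Qed.

Lemma dominant_rep_card_level x y :
  (forall t, #|level t x| = #|level t y|) -> dominant_rep x = dominant_rep y.
Proof.
move=> xy; apply/rowP => i; rewrite !mxE; congr (nth _ _ _).
apply/perm_sortP.
- by move=> a b; exact: le_total.
- by move=> b a c ab bc; exact: le_trans bc ab.
- by move=> a b /andP[/= ba ab]; apply/eqP; rewrite eq_le ba andbC.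
have cE z t : count_mem t [seq epsilon j z | j <- enum 'I_k] = #|level t z|.
  rewrite count_map -sum1_count big_enum_cond -sum1_card /=.
  by apply: eq_bigl => j; rewrite inE.
by apply/allP => t _; rewrite /= !cE xy.
Qed.

Lemma card_level_rep t x : #|level t (dominant_rep x)| = #|level t x|.
Proof.
have [w ->] := dominant_rep_orbit x.
rewrite -(card_imset _ (@perm_inj _ w^-1%g)); apply: eq_card => i.
apply/imsetP/idP => [[l ly ->]|ix]; first by rewrite !inE /epsilon mxE in ly *.
by exists (w i); rewrite ?permK // !inE /epsilon mxE permK in ix *.
Qed.

(** Sorted coordinates are determined by level sizes, so a W-invariant function sees only how many
    coordinates of a level are lowered. *)
Lemma dominant_rep_lower x y c J K :
  (forall t, #|level t x| = #|level t y|) -> J \subset level c x ->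
  K \subset level c y -> #|J| = #|K| ->
  dominant_rep (lower J x) = dominant_rep (lower K y).
Proof.
move=> xy sJ sK JK; apply: dominant_rep_card_level => t.
by rewrite (card_level_lower t sJ) (card_level_lower t sK) xy JK.
Qed.

Lemma down_closed_card J : (forall i l, l \in J -> (i <= l)%N -> i \in J) ->
  forall i, (i \in J) = (i < #|J|)%N.
Proof.
move=> dJ i; have cI n : (n <= k)%N -> #|[set l : 'I_k | (l < n)%N]| = n.
  by move=> le_n; rewrite -[RHS]subn0 -(card_ord_interval 0 le_n).
apply/idP/idP => [Ji|].
  rewrite -{1}(cI i.+1) //; apply: subset_leq_card; apply/subsetP => l.
  by rewrite inE ltnS; apply: dJ.
apply: contraTT => nJi; rewrite -leqNgt -(cI i); last exact: ltnW.
apply: subset_leq_card; apply/subsetP => l Jl; rewrite inE ltnNge.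
by apply: contra nJi => /(dJ _ _ Jl).
Qed.

(** For dominant [y], the position at which the level [c] begins. *)
Definition start c y : nat := #|[set i | c < epsilon i y]|.

(** The positions with coordinate [> c], and those with coordinate [>= c], form initial segments;
    the level is their difference. *)
Lemma mem_level_dominant c y i : dominant y ->
  (i \in level c y) = (start c y <= i < start c y + #|level c y|)%N.
Proof.
move=> dy; pose B := [set i | c < epsilon i y].
have -> : (start c y + #|level c y| = #|B :|: level c y|)%N.
  rewrite cardsU [X in (_ - X)%N](_ : _ = 0%N) ?subn0 //.
  apply/eqP; rewrite cards_eq0 -subset0; apply/subsetP => l.
  by rewrite !inE => /andP[lt_c /eqP Ec]; rewrite Ec ltxx in lt_c.
have BU l : (l \in B :|: level c y) = (c <= epsilon l y).
  by rewrite !inE orbC eq_sym -le_eqVlt.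
rewrite leqNgt -(@down_closed_card B) -?down_closed_card ?BU ?inE.
- by case: ltgtP.
- by move=> l j; rewrite !BU => le_c /dy; apply: le_trans.
- by move=> l j; rewrite !inE => lt_c /dy; apply: lt_le_trans.
Qed.

End Levels.

(** * The Hamiltonian as a sum over levels *)

Section HamiltonianByLevel.
Variables (F : fieldType) (k : nat).
Implicit Types (x : lattice k.+1) (c : int) (f : lattice k.+1 -> F).

Lemma sum_by_value (V : nmodType) (I : finType) (P : pred I) (key : I -> int)
    (r : seq int) (G : I -> V) : uniq r -> (forall i, P i -> key i \in r) ->
  \sum_(i | P i) G i = \sum_(c <- r) \sum_(i | P i && (key i == c)) G i.
Proof.
move=> ru kr; under [RHS]eq_bigr do rewrite big_mkcondr.
rewrite exchange_big /=; apply: eq_bigr => i /kr kir.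
rewrite -big_mkcond /= (eq_bigl (pred1 (key i))) => [|c]; last by rewrite /= eq_sym.
by rewrite -big_filter filter_pred1_uniq // big_seq1.
Qed.

Lemma foldr_Xhat f (j : seq 'I_k.+1) x :
  foldr (@Xhat F k.+1) f j x = f (x - \sum_(i <- j) basisv i).
Proof.
elim: j x => [|i j IH] x /=; first by rewrite big_nil subr0.
by rewrite /Xhat IH big_cons opprD addrA.
Qed.

Lemma foldr_Xhat_lower f n (j : n.-tuple 'I_k.+1) x : increasing_tuple j ->
  foldr (@Xhat F k.+1) f j x = f (lower [set i in j] x).
Proof.
move=> /increasing_tuple_uniq uj; rewrite foldr_Xhat /lower.
by rewrite big_uniq //= [in RHS]big_set.
Qed.

Lemma delta_eq_level n (j : n.+1.-tuple 'I_k.+1) x :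
  delta_eq F j x = ([set i in j] \subset level (epsilon (thead j) x) x)%:R.
Proof.
rewrite /delta_eq; case/tupleP: j => i j; rewrite theadE /=; congr ((nat_of_bool _)%:R).
rewrite all_map; apply/idP/idP => [/allP jP|/subsetP jP].
  by apply/subsetP => l; rewrite !inE => /predU1P[->//|/jP].
by apply/allP => l jl; have := jP l; rewrite !inE jl orbT; apply.
Qed.

Variables (beta gamma q : F).

(** Where [delta_eq] is nonzero the tuple is a subset of one level, [dminus] is the rank there, and
    [dplus + dminus] is the level size minus one. Only the power of [q] varies, and its sum is a
    Gaussian binomial. *)
Lemma hop_level n f x c (Fn : F) :
  (forall J : {set 'I_k.+1}, J \subset level c x -> #|J| = n.+1 ->
     f (lower J x) = Fn) ->
  \sum_(j : n.+1.-tuple 'I_k.+1 | increasing_tuple j && (epsilon (thead j) x == c))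
    q ^+ (\sum_(l < n.+1) dminus (tnth j l) x - (n.+1 * n)./2)%N
    * delta_eq F j x
    / (\prod_(l < n.+1) (1 + beta * gamma
         * qint q (dplus (thead j) x + dminus (thead j) x - l)%N))
    * foldr (@Xhat F k.+1) f j x
  = qbinom q #|level c x| n.+1
    / \prod_(l < n.+1) den beta gamma q (#|level c x|.-1 - l) * Fn.
Proof.
move=> fFn; pose A := level c x.
rewrite -sum_rank_qbinom !mulr_suml.
rewrite -(sum_increasing_tuple n.+1 ord0 (fun J : {set _} => J \subset A)
  (fun J => q ^+ (\sum_(i in J) rank A i - (n.+1 * n)./2)
    / \prod_(l < n.+1) den beta gamma q (#|A|.-1 - l) * Fn)).
rewrite [LHS]big_mkcondr [RHS]big_mkcondr; apply: eq_bigr => j jI.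
have hj : thead j \in [set i in j] by rewrite inE; apply: mem_tnth.
rewrite delta_eq_level; case: ifP => [/eqP Ec|nEc]; last first.
  case: ifP => // /subsetP/(_ _ hj); by rewrite inE nEc.
rewrite Ec -/A; case: ifP => sJ; last by rewrite mulr0 !mul0r.
rewrite mulr1 dplus_dminus Ec -/A foldr_Xhat_lower // fFn //; last first.
  by rewrite cardsE (card_uniqP (increasing_tuple_uniq jI)) size_tuple.
congr (q ^+ (_ - _) / _ * _).
rewrite big_set -big_uniq ?increasing_tuple_uniq //= big_tuple.
apply: eq_bigr => l _; rewrite dminus_rank; congr (rank (level _ _) _).
have /(subsetP sJ) : tnth j l \in [set i in j] by rewrite inE mem_tnth.
by rewrite inE => /eqP.
Qed.


Lemma hamiltonian_by_level (alpha delta : F) f x (r : seq int)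
    (Fn : int -> nat -> F) :
  uniq r -> (forall i, epsilon i x \in r) ->
  (forall c (J : {set 'I_k.+1}) n, J \subset level c x -> #|J| = n.+1 ->
     f (lower J x) = Fn c n) ->
  hamiltonian alpha beta gamma delta q f x
  = \sum_(c <- r) (\sum_(n < #|level c x|)
        cluster_coef beta gamma delta q #|level c x| n * Fn c n
      - alpha * gamma
        * (\sum_(d < #|level c x|) qint q d / den beta gamma q d) * f x).
Proof.
move=> ru xr fFn; rewrite /hamiltonian big_split /= addrC; congr (_ + _); last first.
  under eq_bigr => n _ do rewrite (sum_by_value (key := fun j : n.+1.-tuple 'I_k.+1 =>
    epsilon (thead j) x) (r := r)) // mulr_sumr.
  rewrite exchange_big /=; apply: eq_bigr => c _.
  have le_c : (#|level c x| <= k.+1)%N.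
    by rewrite -[leqRHS]card_ord; apply: max_card.
  (* The sum over cluster sizes may run up to [k], as clusters larger than the level have
     coefficient 0. *)
  rewrite (big_ord_widen _ (fun n => cluster_coef beta gamma delta q #|level c x| n
    * Fn c n) le_c) [RHS]big_mkcond /=; apply: eq_bigr => n _.
  rewrite (hop_level (Fn := Fn c n)); last by move=> J; apply: fFn.
  rewrite !mulrA -/(cluster_coef beta gamma delta q _ _).
  by case: ltnP => // le_n; rewrite cluster_coef_small // mul0r.
rewrite sumrN -mulr_suml -mulr_sumr !mulNr; congr (- (_ * _ * _)).
rewrite (sum_by_value (key := fun j => epsilon j x) (r := r)) //.
apply: eq_bigr => c _.
rewrite -(sum_dplus (fun d => qint q d / den beta gamma q d)).
by apply: eq_bigl => i; rewrite inE.
Qed.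

End HamiltonianByLevel.

(** * Lowering the end of a level of a dominant point *)

Lemma leq_start_level k c (y : lattice k) : (start c y + #|level c y| <= k)%N.
Proof.
rewrite -[leqRHS](card_ord k) -(cardsC [set i | c < epsilon i y]) leq_add2l.
apply: subset_leq_card; apply/subsetP => i; rewrite !inE => /eqP->.
by rewrite ltxx.
Qed.

(** Among the subsets of the level with [n] elements, this one keeps a dominant point dominant when
    lowered, so it represents them all. *)
Definition level_end k c (y : lattice k) n : {set 'I_k} :=
  [set i : 'I_k | (start c y + #|level c y| - n <= i < start c y + #|level c y|)%N].

Lemma card_level_end k c (y : lattice k) n : (n <= #|level c y|)%N ->
  #|level_end c y n| = n.
Proof.
by move=> le_n; rewrite card_ord_interval ?leq_start_level //; lia.
Qed.

Lemma level_end_sub k c (y : lattice k) n : dominant y -> (n <= #|level c y|)%N ->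
  level_end c y n \subset level c y.
Proof.
move=> dy le_n; apply/subsetP => i; rewrite (mem_level_dominant _ _ dy) inE; lia.
Qed.

Lemma dominant_lower_end k c (y : lattice k) n : dominant y ->
  (n <= #|level c y|)%N -> dominant (lower (level_end c y n) y).
Proof.
move=> dy le_n i j le_ij; rewrite !epsilon_lower; have le_y := dy i j le_ij.
have [iE|niE] := boolP (i \in _); last first.
  by rewrite subr0; apply: le_trans le_y; rewrite gerBl; case: (_ \in _).
have [jE|njE] := boolP (j \in _); first by rewrite lerD2r.
have /(subsetP (level_end_sub dy le_n)) := iE; rewrite inE => /eqP Ei.
(* The critical case: [i] is lowered and the later [j] is not. Then [j] lies beyond the level and
   its coordinate is strictly smaller. *)
have : j \notin level c y.
  apply: contra njE; rewrite (mem_level_dominant _ _ dy) => /andP[_ lt_j].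
  by move: iE; rewrite !inE lt_j andbT => /andP[le_i _]; apply: leq_trans le_ij.
rewrite inE -Ei subr0 => nE; move: le_y; rewrite le_eqVlt (negbTE nE) /= mulr1n; lia.
Qed.

(** * The eigenvalue equation *)

Section Eigenfunction.
Variables (F : fieldType) (alpha beta gamma delta q : F) (k : nat).
Variable p : 'I_k.+1 -> F.
Hypothesis q_def : q = 1 + beta * gamma - alpha * delta.
Hypothesis p_inj : injective p.
Hypothesis p_neq0 : forall i, p i != 0.
Hypothesis den_neq0 : forall n, den beta gamma q n != 0.
Implicit Types (x y : lattice k.+1) (c : int) (s : 'S_k.+1).

Definition wave y s : F := \prod_(i < k.+1) p (s i) ^ (- epsilon i y).

Lemma bethe_sumE y : bethe_sum alpha beta gamma delta p y
  = \sum_s bethe_coef alpha beta gamma delta p s * wave y s.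
Proof. by []. Qed.

(** Exchanging two positions inside a level leaves the exponents unchanged. *)
Lemma wave_sym c y : dominant y ->
  block_sym (start c y) (start c y + #|level c y|) (wave y).
Proof.
move=> dy i le_i lt_i s; have le_k := leq_start_level c y.
have Ey l : epsilon (adj k i l) y = epsilon l y.
  have yE n : (i <= n <= i.+1)%N -> epsilon (inord n) y = c.
    move=> n_i; apply/eqP.
    have : inord n \in level c y by rewrite (mem_level_dominant _ _ dy) inordK; lia.
    by rewrite inE.
  by rewrite /adj; case: tpermP => // ->; rewrite !yE ?leqnn ?leqnSn.
rewrite /wave (reindex_inj (@perm_inj _ (adj k i))) /=.
by apply: eq_bigr => l _; rewrite permM /adj tpermK Ey.
Qed.

Lemma wave_lower_end c y n s : wave (lower (level_end c y n) y) s
  = bvar_prod p (start c y + #|level c y| - n) (start c y + #|level c y|) s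
    * wave y s.
Proof.
rewrite /bvar_prod -(big_ord_interval (k := k.+1) _ _ (fun t => bvar p t s));
  last exact: leq_start_level.
rewrite -/(level_end c y n) big_mkcond -big_split /=; apply: eq_bigr => i _.
rewrite epsilon_lower /bvar inord_val opprB.
case: (i \in _); last by rewrite sub0r mul1r.
by rewrite mulr1n expfzDr // expr1z.
Qed.

Lemma Phi_lower x c (J : {set 'I_k.+1}) n : J \subset level c x -> #|J| = n ->
  let y := dominant_rep x in
  Phi alpha beta gamma delta p (lower J x)
  = \sum_s bethe_coef alpha beta gamma delta p s
      * (bvar_prod p (start c y + #|level c y| - n) (start c y + #|level c y|) s
         * wave y s).
Proof.
move=> sJ Jn y; have dy := dominant_rep_dominant x.
have cy t : #|level t y| = #|level t x| by apply: card_level_rep.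
have le_n : (n <= #|level c y|)%N by rewrite cy -Jn subset_leq_card.
rewrite /Phi /W_extend.
have -> : dominant_rep (lower J x) = lower (level_end c y n) y.
  rewrite -[RHS](dominant_rep_id (dominant_lower_end dy le_n)).
  apply: (dominant_rep_lower _ sJ (level_end_sub dy le_n)) => [t|].
    by rewrite cy.
  by rewrite card_level_end.
by rewrite bethe_sumE; apply: eq_bigr => s _; rewrite wave_lower_end.
Qed.

Theorem Phi_eigenfunction :
  is_eigenfunction (hamiltonian alpha beta gamma delta q) (\sum_(i < k.+1) p i)
    (Phi alpha beta gamma delta p).
Proof.
move=> x; pose y := dominant_rep x; have dy : dominant y := dominant_rep_dominant x.
have cy t : #|level t y| = #|level t x| by apply: card_level_rep.
(* The distinct coordinates of [y]; they are also those of [x], since the level sizes agree. *)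
pose r := undup [seq epsilon i y | i <- enum 'I_k.+1].
have yr i : epsilon i y \in r.
  by rewrite mem_undup (map_f (fun i => epsilon i y)) ?mem_enum.
have xr i : epsilon i x \in r.
  have : i \in level (epsilon i x) x by rewrite inE.
  move=> ix; have : (0 < #|level (epsilon i x) y|)%N by rewrite cy (cardD1 i) ix.
  by case/card_gt0P => l; rewrite inE => /eqP <-.
rewrite (hamiltonian_by_level _ _ _ _ _ (undup_uniq _) xr
  (fun c J n sJ Jn => Phi_lower sJ Jn)).
have -> : Phi alpha beta gamma delta p x
  = \sum_s bethe_coef alpha beta gamma delta p s * wave y s by [].
set A := bethe_coef _ _ _ _ _.
(* Level by level, [bethe_null_cluster] replaces the cluster sum by the sum of the variables of the
   level. *)
transitivity (\sum_(c <- r) \sum_s A s *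
    ((\sum_(start c y <= t < start c y + #|level c y|) bvar p t s) * wave y s)).
  apply: eq_bigr => c _; rewrite -cy.
  have /= := bethe_null_cluster q_def p_inj den_neq0
    (leq_start_level c y) (wave_sym dy).
  rewrite /bethe_null /=; under eq_bigr do rewrite mulrBl mulrBr.
  rewrite sumrB => /eqP; rewrite subr_eq0 => /eqP <-.
  rewrite /cluster_sum.
  under [RHS]eq_bigr do rewrite mulrBl mulrBr.
  rewrite sumrB; congr (_ - _).
    under [RHS]eq_bigr do rewrite mulr_suml mulr_sumr.
    rewrite exchange_big /=; apply: eq_bigr => n _; rewrite mulr_sumr.
    by apply: eq_bigr => s _; rewrite -?/y -/A; ring.
  by rewrite mulr_sumr; apply: eq_bigr => s _; rewrite -?/y -/A; ring.
(* Over all levels these sums add up to the sum of all [z_t], which is the sum of the [p i] for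
   every permutation. *)
rewrite exchange_big mulr_sumr /=; apply: eq_bigr => s _.
rewrite -mulr_sumr -mulr_suml mulrCA; congr (_ * (_ * _)).
rewrite [RHS](reindex_inj (@perm_inj _ s)) /=.
rewrite [RHS](sum_by_value (key := fun i => epsilon i y) (r := r)) ?undup_uniq //.
apply: eq_bigr => c _.
rewrite -(big_ord_interval (k := k.+1) _ _ (fun t => bvar p t s)) ?leq_start_level //.
apply: eq_big => i; last by rewrite /bvar inord_val.
by rewrite inE -mem_level_dominant // inE.
Qed.

End Eigenfunction.

Theorem proposition3p15 (R : realType) (k : nat) (k_ge2 : (2 <= k)%N)
    (alpha beta gamma delta q : R[i])
    (q_def : q = 1 + beta * gamma - alpha * delta)
    (qint_neq : forall n : nat, (0 < n)%N -> 1 + beta * gamma * qint q n != 0)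
    (p : 'I_k -> R[i]) (p_inj : injective p) (p_neq0 : forall i, p i != 0) :
  is_eigenfunction (hamiltonian alpha beta gamma delta q) (\sum_(i < k) p i)
    (Phi alpha beta gamma delta p).
Proof.
case: k k_ge2 p p_inj p_neq0 => // k _ p p_inj p_neq0.
(* The denominators are assumed nonzero for positive [n]; the remaining one, [den 0], equals 1. *)
apply: Phi_eigenfunction => // -[|n]; last exact: qint_neq.
by rewrite den0 oner_neq0.
Qed.
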